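(* Let $(X,\mathcal{A})$ be a measurable space and $\mu$ a measure on it. Then $\mu$ is non-atomic if and only if every $\mu$-bounded set $A\in\mathcal{A}$ satisfies $\mu(A)=0$.
   Context: $X$ is a non-empty set, $\mathcal{A}$ a $\sigma$-algebra on $X$, $\mu:\mathcal{A}\to[0,\infty]$ a measure; $\mathcal{M}(X,\mathcal{A})$ is the set of all measurable functions $X\to\mathbb{R}$. An atom is a set $A\in\mathcal{A}$ with $\mu(A)>0$ that cannot be written as a disjoint union $A=B\sqcup C$ with $B,C\in\mathcal{A}$ and $\mu(B)>0$, $\mu(C)>0$. The measure $\mu$ is non-atomic if there are no atoms. A subset $Y\subseteq X$ is $\mu$-bounded if for every $f\in\mathcal{M}(X,\mathcal{A})$ there is a set $E\in\mathcal{A}$ with $\mu(E)=0$ such that $f$ is bounded on $Y\setminus E$. *)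

(* Defs.v *)
From HB Require Import structures.
From mathcomp Require Import all_boot all_order all_algebra.
From mathcomp Require Import all_classical all_reals all_analysis.

Set Implicit Arguments.
Unset Strict Implicit.
Unset Printing Implicit Defensive.

Import Order.TTheory GRing.Theory Num.Theory.
Import numFieldNormedType.Exports.

Local Open Scope classical_set_scope.
Local Open Scope ring_scope.
Local Open Scope ereal_scope.

(* The space is nonempty because [measurableType] inherits from
   [pointedType]. *)

Definition is_atom (d : measure_display) (T : measurableType d) (R : realType)
    (mu : {measure set T -> \bar R}) (A : set T) : Prop :=
  [/\ measurable A, 0 < mu A &
    ~ exists B C : set T,
        [/\ measurable B /\ measurable C, A = B `|` C, B `&` C = set0,
            0 < mu B & 0 < mu C]].

Definition non_atomic (d : measure_display) (T : measurableType d)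
    (R : realType) (mu : {measure set T -> \bar R}) : Prop :=
  ~ exists A : set T, is_atom mu A.

Definition measure_bounded (d : measure_display) (T : measurableType d)
    (R : realType) (mu : {measure set T -> \bar R}) (Y : set T) : Prop :=
  forall f : T -> R, measurable_fun setT f ->
    exists E : set T,
      [/\ measurable E, mu E = 0 & [bounded f x | x in Y `\` E]].

(* Main.v *)
Require Import Defs.
From HB Require Import structures.
From mathcomp Require Import all_boot all_order all_algebra.
From mathcomp Require Import all_classical all_reals all_analysis.
From mathcomp Require Import measurable_realfun.

(* On an atom, a measurable function is almost everywhere bounded, since by
   countable additivity one of the sublevel sets of |f| has positive measure,
   so its complement in the atom is null.  Conversely, in the absence of
   atoms, a set of positive measure contains a decreasing sequence of
   measurable sets [C n] with all differences [C n `\` C n.+1] of positive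
   measure, and the function equal to [n] on the n-th difference is essentially
   unbounded. *)

Import Order.TTheory GRing.Theory Num.Theory.
Import numFieldNormedType.Exports.

Local Open Scope classical_set_scope.
Local Open Scope ring_scope.

Lemma atom_measure_bounded (d : measure_display) (T : measurableType d)
    (R : realType) (mu : {measure set T -> \bar R}) (A : set T) :
  is_atom mu A -> measure_bounded mu A.
Proof.
move=> [mA muA atomA] f mf.
pose L n := A `&` [set x | `|f x| <= n%:R].
have mL n : measurable (L n).
  apply: measurable_fun_le => //; apply: measurable_funTS.
  exact: (measurableT_comp (@normr_measurable R setT) mf).
have [n muL] : exists n, mu (L n) != 0%E.
  apply: contrapT => /forallNP L0.
  have : mu.-negligible A.
    apply: (@negligibleS _ _ _ _ (\bigcup_n L n)).
      move=> x Ax; exists (Num.bound `|f x|) => //; split=> //=.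
      by rewrite ltW// archi_boundP.
    apply: negligible_bigcup => k; apply/negligibleP => //.
    by apply/eqP; have /negP := L0 k; rewrite negbK.
  by move/(measure_negligible mA) => A0; rewrite A0 ltxx in muA.
have mD : measurable (A `\` L n) by exact: measurableD.
exists (A `\` L n); split => //.
  (* If the rest of [A] were not null, it would split the atom together with [L n]. *)
  apply/eqP; apply: contrapT => /negP D0; apply: atomA.
  exists (L n), (A `\` L n); split=> //.
  - by rewrite setDUK// => x [].
  - by rewrite setDIK.
  - by rewrite measure_gt0.
  - by rewrite measure_gt0.
exists n%:R; split=> [|M nM x [Ax nDx]]; first exact: realn.
have [[_ fxn]|nLx] := pselect (L n x); last by case: nDx.
exact: le_trans fxn (ltW nM).
Qed.

(** The function is a series of indicators weighted by their indices. Summing in [\bar R] gives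
    measurability from nonnegativity alone; by disjointness at most one term is nonzero at each
    point, so [fine] loses nothing. *)
Lemma measurable_index_fun (d : measure_display) (T : measurableType d)
    (R : realType) (B : nat -> set T) :
  (forall n, measurable (B n)) -> trivIset setT B ->
  exists2 f : T -> R, measurable_fun setT f &
    forall n x, B n x -> f x = n%:R.
Proof.
move=> mB tB.
pose g x := (\sum_(0 <= k <oo) (k%:R * \1_(B k) x)%:E : \bar R)%E.
exists (fine \o g).
  apply: measurableT_comp; first exact: fine_measurable.
  apply: ge0_emeasurable_sum => // k _.
  by apply/measurable_EFinP/measurable_funM.
move=> n x Bnx /=; rewrite /g (@nneseriesD1 _ _ n)//.
rewrite eseries0 ?adde0/= => [|k _ kn]; first by rewrite indicE mem_set// mulr1.
rewrite indicE memNset ?mulr0// => Bkx.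
by move: kn; rewrite (tB k n)// ?eqxx//; exists x.
Qed.

(** Replaces the disjoint union in the definition of an atom by a subset and its difference, a form
    that can be iterated. *)
Lemma non_atomic_split (d : measure_display) (T : measurableType d)
    (R : realType) (mu : {measure set T -> \bar R}) (C : set T) :
  non_atomic mu -> measurable C -> (0 < mu C)%E ->
  exists C', [/\ measurable C', C' `<=` C, (0 < mu C')%E &
    (0 < mu (C `\` C'))%E].
Proof.
move=> na mC muC; apply: contrapT => nsplit; apply: na; exists C; split=> //.
move=> [B [D [[mB mD] CBD BD muB muD]]]; apply: nsplit; exists B; split=> //.
  by rewrite CBD.
rewrite CBD setDUl setDv set0U setDE setIidl//.
by move=> x Dx Bx; rewrite -[False]/(set0 x) -BD.
Qed.

Lemma non_atomic_disjoint_seq (d : measure_display) (T : measurableType d)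
    (R : realType) (mu : {measure set T -> \bar R}) (A : set T) :
  non_atomic mu -> measurable A -> (0 < mu A)%E ->
  exists B : nat -> set T, [/\ trivIset setT B,
    forall n, measurable (B n), forall n, B n `<=` A &
    forall n, (0 < mu (B n))%E].
Proof.
move=> na mA muA.
(* The hypotheses on [C] sit inside the existential so that [h] is total and can be iterated; on
   other sets its value is arbitrary. *)
have /choice[h hP] (C : set T) : exists C' : set T,
    measurable C -> (0 < mu C)%E -> [/\ measurable C', C' `<=` C,
      (0 < mu C')%E & (0 < mu (C `\` C'))%E].
  have [[mC muC]|nC] := pselect (measurable C /\ (0 < mu C)%E).
    by have [C' ?] := non_atomic_split _ _ _ mu C na mC muC; exists C'.
  by exists set0 => mC muC; case: nC.
pose C n := iter n h A.
have CP n : measurable (C n) /\ (0 < mu (C n))%E.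
  by elim: n => [//|n [mC muC]]; have [] := hP _ mC muC.
have CS n : [/\ measurable (C n.+1), C n.+1 `<=` C n, (0 < mu (C n.+1))%E &
    (0 < mu (C n `\` C n.+1))%E] by have [mC muC] := CP n; exact: hP.
have Cle m n : (m <= n)%N -> C n `<=` C m.
  move=> /subnK <-; elim: (n - m)%N => [//|k IH].
  by rewrite addSn; apply: subset_trans IH; have [] := CS (k + m)%N.
exists (fun n => C n `\` C n.+1); split=> [|n|n|n].
(* For [m < n], [C n] lies in [C m.+1], which the difference of index [m] removes. *)
- apply: ltn_trivIset => m n mn; apply/seteqP; split=> // x [[Cm nCm] [Cn _]].
  by case: nCm; exact: Cle Cn.
- by apply: measurableD; [have [] := CP n|have [] := CS n].
- by move=> x [/(Cle 0%N n (leq0n n))].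
- by have [] := CS n.
Qed.

Theorem theorem7p4p4 (d : measure_display) (T : measurableType d)
    (R : realType) (mu : {measure set T -> \bar R}) :
  non_atomic mu <->
  (forall A : set T, measurable A -> measure_bounded mu A -> mu A = 0%E).
Proof.
split=> [na A mA bA|bd0 [A atomA]]; last first.
  have [mA muA _] := atomA.
  by rewrite (bd0 A mA (atom_measure_bounded _ _ _ _ _ atomA)) ltxx in muA.
apply/eqP; apply: contrapT => /negP; rewrite -measure_gt0 => muA.
have [B [tB mB BA muB]] := non_atomic_disjoint_seq _ _ _ _ _ na mA muA.
have [f mf fB] := measurable_index_fun _ _ R _ mB tB.
have [E [mE muE [M [_ fM]]]] := bA _ mf.
(* Boundedness gives [|f| <= K] off [E] only for [K] strictly above [M], whence [K = |M| + 1]. As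
   [f] equals [n > K] on [B n], that set must lie in the null set [E]. *)
pose n := Num.bound (`|M| + 1).
have : B n `<=` E.
  move=> x Bx; apply: contrapT => Ex.
  have := fM (`|M| + 1); rewrite (le_lt_trans (ler_norm M)) ?ltrDl//.
  move=> /(_ isT x (conj (BA _ _ Bx) Ex)) /=; rewrite (fB n)// normr_nat.
  by rewrite leNgt archi_boundP// addr_ge0.
move=> BE; have := muB n.
by rewrite (subset_measure0 (mB n) mE BE muE) ltxx.
Qed.
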